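(* The maps $\zeta^T_{\mathrm{st}}:\mathcal{F}^{\mathrm{conv}}_{\mathbb{N}^*}\to\mathbb{R}$ and $\zeta^{T,\star}_{\mathrm{st}}:\mathcal{F}^{\mathrm{conv}}_{\mathbb{N}^*}\to\mathbb{R}$ are algebra morphisms for the concatenation product of trees.
   Context: $\mathbb{N}^*=\mathbb{Z}_{\ge1}$. A rooted forest is a finite (possibly empty) disjoint union of finite (non-planar) rooted trees; an $\mathbb{N}^*$-decorated forest carries a map from its vertex set to $\mathbb{N}^*$; forests are taken up to isomorphism. $\mathcal{F}_{\mathbb{N}^*}$ is the commutative unital $\mathbb{R}$-algebra freely generated by nonempty $\mathbb{N}^*$-decorated rooted trees: product is concatenation (disjoint union), unit is the empty forest $\emptyset$, forests form a basis. $B_+^\alpha(F)$ is the tree obtained from $F$ by adding a new root decorated by $\alpha$ joined to every root of $F$. A forest is convergent if it is empty or all its roots have decoration $\ge2$; $\mathcal{F}^{\mathrm{conv}}_{\mathbb{N}^*}$ is the subalgebra spanned by convergent forests. For $\lambda\in\{0,-1\}$, $\mathcal{Z}_\lambda(F):\mathbb{N}^*\to\mathbb{R}$ is defined by $\mathcal{Z}_\lambda(\emptyset)=1$, $\mathcal{Z}_\lambda(F_1F_2)=\mathcal{Z}_\lambda(F_1)\mathcal{Z}_\lambda(F_2)$ (pointwise product), $\mathcal{Z}_\lambda(B_+^\alpha(F))(N)=\sum_{n=1}^{N+\lambda}n^{-\alpha}\,\mathcal{Z}_\lambda(F)(n)$ (an empty sum is $0$). For convergent $F$ the finite limits $\zeta^T_{\mathrm{st}}(F)=\lim_{N\to\infty}\mathcal{Z}_{-1}(F)(N)$,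 $\zeta^{T,\star}_{\mathrm{st}}(F)=\lim_{N\to\infty}\mathcal{Z}_0(F)(N)$ exist; extend linearly. *)

(* Defs.v *)
From HB Require Import structures.
From mathcomp Require Import all_boot all_order all_algebra.
From mathcomp Require Import generic_quotient finmap.
From mathcomp Require Import all_classical all_reals all_analysis.
(* The notations of monalg (level of _ %:MP) clash with those of analysis. *)
From mathcomp Require Import -(notations) monalg.

Set Implicit Arguments.
Unset Strict Implicit.
Unset Printing Implicit Defensive.

Import Order.TTheory GRing.Theory Num.Theory.
Import numFieldNormedType.Exports.

Local Open Scope ring_scope.
Local Open Scope quotient_scope.
Local Open Scope classical_set_scope.

Notation "{ 'cmonom' I }" := (cmonom I) (at level 0, I at level 2) : type_scope.
Notation "{ 'malg' R [ K ] }" := (@malg K R)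
  (at level 0, K, R at level 2) : type_scope.

Definition Nstar : Type := {n : nat | (0 < n)%N}.
HB.instance Definition _ := Countable.on Nstar.

(* Planar representatives of decorated rooted trees: a root decoration and the
   list of the subtrees hanging from the root. *)
Inductive ptree : Type := PNode of Nstar & seq ptree.

Lemma ptree_elim (P : ptree -> Prop) :
    (forall a s, foldr (fun t X => P t /\ X) True s -> P (PNode a s)) ->
  forall t, P t.
Proof.
move=> H; fix IH 1 => -[a s]; apply: H.
by elim: s.
Qed.

Fixpoint ptree_enc (t : ptree) : GenTree.tree Nstar :=
  let: PNode a s := t in GenTree.Node 0 (GenTree.Leaf a :: map ptree_enc s).

Fixpoint ptree_dec (g : GenTree.tree Nstar) : option ptree :=
  if g is GenTree.Node _ (GenTree.Leaf a :: s)
  then Some (PNode a (pmap ptree_dec s)) else None.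

Lemma ptree_encK : pcancel ptree_enc ptree_dec.
Proof.
elim/ptree_elim => a s IH /=; congr (Some (PNode _ _)).
by elim: s IH => //= t s IHs [-> /IHs ->].
Qed.

HB.instance Definition _ := Countable.copy ptree (pcan_type ptree_encK).

Lemma ptree_ind_mem (P : ptree -> Prop) :
    (forall a s, {in s, forall t, P t} -> P (PNode a s)) -> forall t, P t.
Proof.
move=> H; elim/ptree_elim => a s IH; apply: H.
elim: s IH => //= t s IHs [Pt /IHs Ps] u; rewrite inE.
by case/predU1P => [->|/Ps].
Qed.

(* Isomorphism of rooted trees: equal root decorations and a bijection between
   the lists of subtrees that matches isomorphic subtrees. *)
Fixpoint tree_iso (t u : ptree) : bool :=
  let: PNode a s := t in let: PNode b v := u in
  (a == b) && has (all2 tree_iso s) (permutations v).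

Lemma tree_isoP a s b v :
  reflect (a = b /\ exists2 w, perm_eq w v & all2 tree_iso s w)
          (tree_iso (PNode a s) (PNode b v)).
Proof.
apply: (iffP andP) => -[].
  by move=> /eqP-> /hasP[w]; rewrite mem_permutations => ? ?; split=> //; exists w.
move=> -> [w wv sw]; split=> //; apply/hasP; exists w => //.
by rewrite mem_permutations.
Qed.

Lemma all2_perm (T : eqType) (r : rel T) (s w v : seq T) :
  all2 r s w -> perm_eq w v -> exists2 s', perm_eq s' s & all2 r s' v.
Proof.
case: v => [|x0 v']; first by move=> sw /perm_nilP w0; exists s; rewrite // -w0.
set v := _ :: v'; clearbody v.
rewrite all2E => /andP[/eqP ssw /(all_nthP (x0, x0)) rsw] wv.
have /(perm_iotaP x0)[I Iw ->] : perm_eq v w by rewrite perm_sym.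
exists [seq nth x0 s i | i <- I]; first by apply/(perm_iotaP x0); exists I; rewrite // ssw.
rewrite all2E !size_map eqxx /= zip_map all_map; apply/allP => i.
rewrite (perm_mem Iw) mem_iota /= add0n => iw.
by have := rsw i; rewrite size_zip ssw minnn nth_zip //=; apply.
Qed.

Lemma all2_all (T : eqType) (r r' : rel T) (s v : seq T) :
  (forall x y, x \in s -> r x y -> r' x y) -> all2 r s v -> all2 r' s v.
Proof.
elim: s v => [|x s IH] [|y v] //= rr' /andP[xy sv].
rewrite rr' ?mem_head //= IH // => a b als; apply: rr'.
by rewrite inE als orbT.
Qed.

Lemma all2_flip (T : eqType) (r : rel T) (s v : seq T) :
  all2 r s v = all2 (fun x y => r y x) v s.
Proof. by elim: s v => [|x s IH] [|y v] //=; rewrite IH. Qed.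

Lemma all2_comp (T : eqType) (r : rel T) (s v w : seq T) :
  (forall x y z, x \in s -> r x y -> r y z -> r x z) ->
  all2 r s v -> all2 r v w -> all2 r s w.
Proof.
elim: s v w => [|x s IH] [|y v] [|z w] //= rr /andP[xy sv] /andP[yz vw].
rewrite (rr x y z) ?mem_head //= (IH v w) // => a b c als; apply: rr.
by rewrite inE als orbT.
Qed.

Lemma tree_iso_refl : reflexive tree_iso.
Proof.
elim/ptree_ind_mem => a s IH; apply/tree_isoP; split=> //; exists s => //.
elim: s IH => //= t s IHs IH; rewrite IH ?mem_head //= IHs // => u us.
by apply: IH; rewrite inE us orbT.
Qed.

Lemma tree_iso_sym : symmetric tree_iso.
Proof.
suff H t u : tree_iso t u -> tree_iso u t by move=> t u; apply/idP/idP; exact: H.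
elim/ptree_ind_mem: t u => a s IH [b v] /tree_isoP[-> [w wv sw]].
apply/tree_isoP; split=> //; have [s' s's s'v] := all2_perm sw wv.
exists s' => //; rewrite all2_flip.
by apply: all2_all s'v => x y; rewrite (perm_mem s's) => /IH; apply.
Qed.

Lemma tree_iso_trans : transitive tree_iso.
Proof.
move=> u t; elim/ptree_ind_mem: t u => a s IH [b v] [c x].
move=> /tree_isoP[-> [w wv sw]] /tree_isoP[-> [y yx vy]].
apply/tree_isoP; split=> //; have [s' s's s'v] := all2_perm sw wv.
have s'y : all2 tree_iso s' y.
  apply: all2_comp s'v vy => t u z; rewrite (perm_mem s's) => ts tu uz.
  exact: IH tu uz.
rewrite all2_flip in s'y.
have [y' y'y] := all2_perm s'y s's; rewrite -all2_flip => sy'.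
by exists y' => //; apply: perm_trans y'y yx.
Qed.

Canonical tree_iso_equiv :=
  EquivRel tree_iso tree_iso_refl tree_iso_sym tree_iso_trans.

Definition tree : Type := {eq_quot tree_iso_equiv}.
HB.instance Definition _ := Choice.on tree.
HB.instance Definition _ := EqQuotient.on tree.

(* Finite multisets of trees, with the empty forest [mone] as unit and the
   disjoint union [mmul] as product; {malg R[forest]} is then the free
   commutative algebra on trees, with the forests as a basis. *)
Notation forest := {cmonom tree}.

Definition forest_seq (F : forest) : seq tree :=
  flatten [seq nseq (F t) t | t <- finsupp F].

(* B_+^a, grafting the trees of F on a new root decorated by a. *)
Definition Bplus (a : Nstar) (F : forest) : tree :=
  \pi_tree (PNode a (map repr (forest_seq F))).

Definition root_dec (t : tree) : Nstar := let: PNode a _ := repr t in a.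

Lemma repr_Bplus a F : exists w s,
  [/\ repr (Bplus a F) = PNode a s, perm_eq w (map repr (forest_seq F))
    & all2 tree_iso s w].
Proof.
have /eqmodP : repr (Bplus a F) = PNode a (map repr (forest_seq F)) %[mod tree].
  by rewrite reprK.
case: (repr _) => b s /tree_isoP[-> [w wF sw]].
by exists w, s.
Qed.

Lemma root_dec_Bplus a F : root_dec (Bplus a F) = a.
Proof. by rewrite /root_dec; have [w [s [-> _ _]]] := repr_Bplus a F. Qed.

Definition forest_of (s : seq tree) : forest := foldr (fun t F => mmul (ucm t) F) mone s.

Lemma forest_ofE s t : forest_of s t = count_mem t s.
Proof.
elim: s => [|u s IH] /=; first by rewrite cm1.
by rewrite cmM cmU IH.
Qed.

Lemma count_forest_seq F t : count_mem t (forest_seq F) = F t.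
Proof.
rewrite /forest_seq count_flatten -map_comp sumnE big_map.
rewrite (eq_bigr (fun u => ((u == t) * F u)%N)); last first.
  by move=> u _ /=; rewrite count_nseq.
have [tF|tF] := boolP (t \in finsupp F).
  rewrite (big_fsetD1 t) //= eqxx mul1n big_seq big1 ?addn0 // => u.
  by rewrite !inE => /andP[/negbTE-> _]; rewrite mul0n.
move: (tF); rewrite -cmE_eq0 => /eqP->.
rewrite big_seq big1 // => u uF.
by case: eqP uF tF => [-> ->|].
Qed.

Lemma forest_seqK F : forest_of (forest_seq F) = F.
Proof. by apply/eqP/cmP => t; rewrite forest_ofE count_forest_seq. Qed.

Lemma BplusP (t : tree) : exists F, t = Bplus (root_dec t) F.
Proof.
rewrite /root_dec; case E: (repr t) => [a s].
exists (forest_of (map \pi_tree s)); rewrite -[LHS]reprK E.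
apply/eqmodP/tree_isoP; split=> //.
pose T := forest_seq (forest_of (map \pi_tree s)).
have pT : perm_eq (map repr (map \pi_tree s)) (map repr T).
  apply: perm_map; rewrite /perm_eq; apply/allP => u _ /=.
  by rewrite /T count_forest_seq forest_ofE.
exists (map repr (map \pi_tree s)); first exact: pT.
elim: s {E T pT} => //= u s ->; rewrite andbT.
by apply/eqmodP; rewrite reprK.
Qed.

(* [Zforest R k F N] is Z_lambda(F)(N) for lambda = - k with k = 0 or 1, and is
   only meaningful for 1 <= N, where the truncated subtraction N - k is exact.
   It is computed on chosen planar representatives; Zforest1, ZforestM and
   Zforest_Bplus are the three defining equations. *)
Section HarmonicSums.
Context (R : realType) (k : nat).

Fixpoint Zptree (t : ptree) (N : nat) : R :=
  let: PNode a s := t in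
  \sum_(1 <= n < (N - k).+1)
    n%:R ^- val a * foldr (fun u x => Zptree u n * x) 1 s.

Definition Zforest (F : forest) (N : nat) : R :=
  \prod_(t <- finsupp F) Zptree (repr t) N ^+ F t.

Lemma ZptreeE a s N : Zptree (PNode a s) N =
  \sum_(1 <= n < (N - k).+1) n%:R ^- val a * \prod_(u <- s) Zptree u n.
Proof.
apply: eq_bigr => n _; congr (_ * _).
by elim: s => [|u s /= ->]; rewrite ?big_nil ?big_cons.
Qed.

Lemma Zptree_iso t u : tree_iso t u -> Zptree t =1 Zptree u.
Proof.
elim/ptree_ind_mem: t u => a s IH [b v] /tree_isoP[-> [w wv sw]] N.
rewrite !ZptreeE; apply: eq_bigr => n _; congr (_ * _).
rewrite -(perm_big _ wv) /=; elim: s w {wv} IH sw => [|t s IHs] [|u w] //= IH.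
case/andP=> tu sw; rewrite !big_cons (IH t _ u) ?mem_head //; congr (_ * _).
by apply: IHs => // x xs; apply: IH; rewrite inE xs orbT.
Qed.

Lemma Zforest_seq F N : Zforest F N = \prod_(t <- forest_seq F) Zptree (repr t) N.
Proof.
rewrite /Zforest /forest_seq big_flatten /= big_map.
by apply: eq_bigr => t _; rewrite big_nseq -Monoid.iteropE.
Qed.

Lemma Zforest1 N : Zforest mone N = 1.
Proof. by rewrite /Zforest mdom1 big_seq_fset0. Qed.

Lemma perm_forest_seqM F G :
  perm_eq (forest_seq (mmul F G)) (forest_seq F ++ forest_seq G).
Proof.
apply/allP => t _ /=; rewrite count_cat !count_forest_seq.
by rewrite cmM.
Qed.

Lemma ZforestM F G N : Zforest (mmul F G) N = Zforest F N * Zforest G N.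
Proof. by rewrite !Zforest_seq (perm_big _ (perm_forest_seqM F G)) big_cat. Qed.

Lemma Zforest_Bplus a F N : Zforest (ucm (Bplus a F)) N =
  \sum_(1 <= n < (N - k).+1) n%:R ^- val a * Zforest F n.
Proof.
rewrite /Zforest mdomU big_seq_fset1 cmUU expr1.
have /eqmodP/Zptree_iso -> :
    repr (Bplus a F) = PNode a (map repr (forest_seq F)) %[mod tree].
  by rewrite reprK.
rewrite ZptreeE; apply: eq_bigr => n _; congr (_ * _).
by rewrite big_map -Zforest_seq.
Qed.

End HarmonicSums.

Definition convergent (F : forest) : bool :=
  all (fun t => (2 <= val (root_dec t))%N) (finsupp F).

Section ConvergentSubalgebra.
Context (R : comNzRingType).

(* The linear span of the convergent forests, see conv_algP. *)
Definition conv_alg : {pred {malg R[forest]}} :=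
  fun p => all convergent (msupp p).

Lemma conv_algP p : reflect
  (exists s : seq (R * forest), all (fun x => convergent x.2) s /\
     p = \sum_(x <- s) x.1 *: mkmalgU x.2 1)
  (p \in conv_alg).
Proof.
apply: (iffP allP) => [pc|[s [/allP sc ->]] F].
  exists [seq (mcoeff F p, F) | F <- msupp p]; split.
    by apply/allP => _ /mapP[F /pc Fc ->].
  rewrite big_map [LHS]monalgE; apply: eq_bigr => F _ /=.
  apply/malgP => G; rewrite mcoeffZ [LHS]mcoeffU.
  by rewrite [X in _ = _ * X](mcoeffU F 1 G) mulrnAr mulr1.
apply: contraTT => Fc; rewrite -mcoeff_eq0 raddf_sum /=.
rewrite big_seq big1 // => x /sc xc; rewrite mcoeffZ mcoeffU.
by case: eqP xc Fc => [-> ->|_] //; rewrite mulr0.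
Qed.

Lemma convergentM F G : convergent F -> convergent G -> convergent (mmul F G).
Proof.
rewrite /convergent mdomD => /allP Fc /allP Gc; apply/allP => t.
by rewrite inE => /orP[/Fc|/Gc].
Qed.

Lemma conv_alg_subalg : GRing.subsemialg_closed conv_alg.
Proof.
have c1 : 1 \in conv_alg.
  apply/conv_algP; exists [:: (1, mone)]; split; last by rewrite big_seq1 scale1r.
  by rewrite /= andbT /convergent mdom1; apply/allP => t; rewrite inE.
split=> //.
- split; first by apply/conv_algP; exists [::]; rewrite big_nil.
  move=> p q /conv_algP[s [sc ->]] /conv_algP[v [vc ->]]; apply/conv_algP.
  by exists (s ++ v); rewrite all_cat sc vc big_cat.
- move=> c p /conv_algP[s [sc ->]]; apply/conv_algP.
  exists [seq (c * x.1, x.2) | x <- s]; rewrite all_map big_map; split=> //.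
  by rewrite scaler_sumr; apply: eq_bigr => x _; rewrite scalerA.
- move=> p q /allP pc /allP qc; apply/allP => F /msuppM_le[G [H [Gp Hq ->]]].
  by apply: convergentM; [exact: pc | exact: qc].
Qed.

HB.instance Definition _ :=
  GRing.isSubalgClosed.Build R {malg R[forest]} conv_alg conv_alg_subalg.

Record Fconv := MkFconv { Fconv_val :> {malg R[forest]}; _ : Fconv_val \in conv_alg }.

HB.instance Definition _ := [isSub for Fconv_val].
HB.instance Definition _ := [Choice of Fconv by <:].
HB.instance Definition _ := [SubChoice_isSubAlgebra of Fconv by <:].
HB.instance Definition _ := [SubNzRing_isSubComNzRing of Fconv by <:].

End ConvergentSubalgebra.

Section Zeta.
Context (R : realType).

(* [mmap idfun h] is the linear extension of h from the basis of forests. *)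
Definition zeta_st (p : Fconv R) : R :=
  mmap idfun (fun F => lim (Zforest R 1 F @ \oo)) (val p).

Definition zeta_st_star (p : Fconv R) : R :=
  mmap idfun (fun F => lim (Zforest R 0 F @ \oo)) (val p).

End Zeta.

(* Main.v *)
From HB Require Import structures.
Require Import Defs.
From mathcomp Require Import all_boot all_order all_algebra.
From mathcomp Require Import all_classical all_reals all_analysis.
From mathcomp Require Import finmap ring lra.
From mathcomp Require Import -(notations) monalg.

Set Implicit Arguments.
Unset Strict Implicit.
Unset Printing Implicit Defensive.

Import Order.TTheory GRing.Theory Num.Theory.
Import numFieldNormedType.Exports.
Local Open Scope ring_scope.
Local Open Scope classical_set_scope.

(** For each fixed N the map F |-> Z(F)(N) is multiplicative on forests, so the
whole content is that the limits exist: the limit of a product is the product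
of the limits only when both factors converge.

The sums of a tree have nonnegative terms and are nondecreasing in N, so
convergence is boundedness. Every decoration is at least 1, hence grafting a
root costs at most one factor of the harmonic number H_N, and every forest,
even a divergent one, satisfies Z(F)(N) <= H_N ^ m for some m ([Zptree_le],
[prod_Zptree_le]). If the root of a tree carries a decoration at least 2, then
its sums are dominated by the partial sums of H_n ^ m / n ^ 2, and these are
bounded by an Abel summation that lowers m ([harmonic_power_sum_rec],
[harmonic_power_sum_ub]). A convergent forest is a finite product of such
trees, so its sums converge ([Zforest_cvg]).

For the passage from forests to the algebra, a product of two forests is
convergent exactly when both factors are. Extending zeta by 0 to the
divergent forests therefore gives a multiplicative map [zeta_conv] on the
whole monoid of forests. Its linear extension is an algebra morphism on the
full algebra of forests, and zeta is the restriction of that morphism to the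
convergent subalgebra. *)

(** * Summability of powers of harmonic numbers over squares *)

Section PowersOfHarmonicNumbers.
Context (R : realType).

Definition harmonic_number (N : nat) : R := \sum_(1 <= n < N.+1) n%:R^-1.

Definition harmonic_power_sum (m N : nat) : R :=
  \sum_(1 <= n < N.+1) n%:R ^- 2 * harmonic_number n ^+ m.

Lemma harmonic_number_ge0 N : 0 <= harmonic_number N.
Proof. by apply: sumr_ge0 => n _; rewrite invr_ge0 ler0n. Qed.

Lemma harmonic_numberS N :
  harmonic_number N.+1 = harmonic_number N + N.+1%:R^-1.
Proof. by rewrite /harmonic_number big_nat_recr. Qed.

Lemma harmonic_power_sumS m N : harmonic_power_sum m N.+1 =
  harmonic_power_sum m N + N.+1%:R ^- 2 * harmonic_number N.+1 ^+ m.
Proof. by rewrite /harmonic_power_sum big_nat_recr. Qed.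

Lemma harmonic_number_homo : {homo harmonic_number : m n / (m <= n)%N >-> m <= n}.
Proof.
apply: homo_leq => // [x y z xy yz|N]; first exact: le_trans xy yz.
by rewrite harmonic_numberS lerDl invr_ge0 ler0n.
Qed.

Lemma exprn_sub_le (x y : R) m : 0 <= y -> y <= x ->
  x ^+ m - y ^+ m <= m%:R * x ^+ m.-1 * (x - y).
Proof.
move=> y0 yx; have x0 := le_trans y0 yx.
rewrite subrXX mulrC ler_wpM2r ?subr_ge0 //.
rewrite (le_trans (y := \sum_(i < m) x ^+ m.-1)) //; last first.
  by rewrite sumr_const card_ord mulr_natl.
apply: ler_sum => i _.
have -> : m.-1 = (m.-1 - i + i)%N by rewrite subnK // -ltnS (ltn_predK (ltn_ord i)).
rewrite exprD addnK -subn1 -subnDA add1n ler_wpM2l ?exprn_ge0 //.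
by rewrite lerXn2r // nnegrE.
Qed.

(** Abel summation of H_n^m against 1/n - 1/(n+1), in inequality form: the
telescoping weight 2/(n(n+1)) dominates 1/n^2, while the increment of H^m at n
is at most m H_n^(m-1) / n. The boundary term on the left is what makes the
bound provable by induction on N. For m = 0 the last term vanishes and the
constant 2 is the value of the boundary term at N = 0, with 0 ^+ 0 = 1. *)
Lemma harmonic_power_sum_rec m N :
  harmonic_power_sum m N + 2 * harmonic_number N ^+ m / N.+1%:R <=
  2 * (m == 0)%:R + 2 * m%:R * harmonic_power_sum m.-1 N.
Proof.
elim: N => [|N IH].
  rewrite /harmonic_power_sum /harmonic_number !big_nil expr0n invr1.
  by rewrite add0r !mulr1 mulr0 addr0.
rewrite !harmonic_power_sumS harmonic_numberS; set h := harmonic_number N in IH *.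
have h0 : 0 <= h by exact: harmonic_number_ge0.
set x := N.+1%:R^-1 : R in IH *; have x0 : 0 < x by rewrite invr_gt0 ltr0n.
have hx : h <= h + x by lra.
have := exprn_sub_le m h0 hx.
have -> : h + x - h = x by ring.
set H := (h + x) ^+ m; set H' := (h + x) ^+ _ => HH'.
have H0 : 0 <= H by rewrite exprn_ge0 // addr_ge0 // ltW.
have -> : N.+1%:R ^- 2 = x ^+ 2 :> R by rewrite exprVn.
have -> : N.+2%:R^-1 = x / (1 + x).
  rewrite -[N.+2]addn1 natrD -[N.+1%:R]invrK -/x; field.
  by apply/andP; split; lra.
(* 1/n^2 <= 2/n - 2/(n+1) at n = N + 1, that is x = 1/n, using x <= 1. *)
have tele : x ^+ 2 * H + 2 * H * (x / (1 + x)) <= 2 * H * x.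
  have -> : 2 * H * (x / (1 + x)) = 2 * H * x - 2 * H * x ^+ 2 / (1 + x).
    by field; lra.
  suff : x ^+ 2 * H <= 2 * H * x ^+ 2 / (1 + x) by lra.
  rewrite ler_pdivlMr; last lra.
  have x1 : x <= 1 by rewrite invf_le1 ?ltr0n // ler1n.
  rewrite -mulrA [_ * (1 + x)]mulrC mulrA.
  suff : (1 + x) * (H * x ^+ 2) <= 2 * (H * x ^+ 2) by lra.
  by rewrite ler_wpM2r ?mulr_ge0 ?sqr_ge0 //; lra.
have : 2 * x * (H - h ^+ m) <= 2 * x * (m%:R * H' * x).
  by rewrite ler_wpM2l //; lra.
lra.
Qed.

Lemma harmonic_power_sum_ub m : exists M, forall N, harmonic_power_sum m N <= M.
Proof.
have lb m' N : harmonic_power_sum m' N <=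
    harmonic_power_sum m' N + 2 * harmonic_number N ^+ m' / N.+1%:R.
  rewrite lerDl divr_ge0 ?ler0n // mulr_ge0 ?ler0n // exprn_ge0 //.
  exact: harmonic_number_ge0.
elim: m => [|m [M HM]].
  exists 2 => N; apply: le_trans (lb _ _) (le_trans (harmonic_power_sum_rec _ _) _).
  by rewrite mulr0 mul0r addr0 mulr1.
exists (2 * m.+1%:R * M) => N.
apply: le_trans (lb _ _) (le_trans (harmonic_power_sum_rec _ _) _).
by rewrite mulr0 add0r ler_wpM2l // mulr_ge0 ?ler0n.
Qed.

End PowersOfHarmonicNumbers.

(** * Convergence of the sums attached to convergent forests *)

Section Convergence.
Context (R : realType) (k : nat).

Lemma Zptree_ge0 t N : 0 <= Zptree R k t N.
Proof.
elim/ptree_ind_mem: t N => a s IH N; rewrite ZptreeE.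
apply: sumr_ge0 => n _; rewrite mulr_ge0 ?invr_ge0 ?exprn_ge0 ?ler0n //.
by rewrite big_seq prodr_ge0 // => u /IH.
Qed.

Lemma Zptree_homo t : {homo Zptree R k t : m n / (m <= n)%N >-> m <= n}.
Proof.
case: t => a s m n mn; rewrite !ZptreeE.
rewrite [leRHS](big_cat_nat _ (n := (m - k).+1)) //=; last by rewrite ltnS leq_sub2r.
rewrite lerDl sumr_ge0 // => i _.
rewrite mulr_ge0 ?invr_ge0 ?exprn_ge0 ?ler0n //.
by rewrite prodr_ge0 // => u _; exact: Zptree_ge0.
Qed.

Lemma prod_Zptree_le s :
    {in s, forall t, exists m, forall N,
       Zptree R k t N <= harmonic_number R N ^+ m} ->
  exists m, forall N,
    \prod_(t <- s) Zptree R k t N <= harmonic_number R N ^+ m.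
Proof.
elim: s => [|t s IHs] IH; first by exists 0 => N; rewrite big_nil.
have [m Hm] := IH t (mem_head _ _).
have [|m' Hm'] := IHs; first by move=> u us; apply: IH; rewrite inE us orbT.
exists (m + m')%N => N; rewrite big_cons exprD ler_pM //; first exact: Zptree_ge0.
by rewrite prodr_ge0 // => u _; exact: Zptree_ge0.
Qed.

(** A root decorated by a contributes n ^- a <= n^-1, and H^m is nondecreasing,
so grafting multiplies the bound by at most one more harmonic number. *)
Lemma Zptree_le t : exists m, forall N, Zptree R k t N <= harmonic_number R N ^+ m.
Proof.
elim/ptree_ind_mem: t => a s /prod_Zptree_le[m Hm].
exists m.+1 => N; rewrite ZptreeE.
have kN : (N - k <= N)%N by exact: leq_subr.
apply: (le_trans (y := harmonic_number R (N - k) * harmonic_number R N ^+ m)).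
  rewrite mulr_suml ler_sum_nat // => n /andP[n0 nN].
  rewrite ler_pM //.
  - by rewrite prodr_ge0 // => u _; exact: Zptree_ge0.
  - rewrite lef_pV2 ?posrE ?exprn_gt0 ?ltr0n // -natrX ler_nat.
    by case: a => -[//|a] _ /=; rewrite expnS leq_pmulr // expn_gt0 n0.
  apply: le_trans (Hm n) _; rewrite lerXn2r ?nnegrE ?harmonic_number_ge0 //.
  by apply: harmonic_number_homo; rewrite (leq_trans _ kN).
by rewrite exprS ler_wpM2r ?exprn_ge0 ?harmonic_number_ge0 ?harmonic_number_homo.
Qed.

Lemma Zptree_cvg a s : (2 <= val a)%N -> cvgn (Zptree R k (PNode a s)).
Proof.
move=> a2; apply: nondecreasing_is_cvgn; first exact: Zptree_homo.
have [|m Hm] := @prod_Zptree_le s; first by move=> t _; exact: Zptree_le.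
have [M HM] := harmonic_power_sum_ub R m.
exists M => _ [N _ <-]; apply: le_trans (HM (N - k)%N); rewrite ZptreeE.
apply: ler_sum_nat => n /andP[n0 _]; rewrite ler_pM //.
- by rewrite prodr_ge0 // => u _; exact: Zptree_ge0.
rewrite lef_pV2 ?posrE ?exprn_gt0 ?ltr0n // -!natrX ler_nat.
by rewrite leq_pexp2l.
Qed.

Lemma Zforest_cvg F : convergent F -> cvgn (Zforest R k F).
Proof.
move=> /allP Fc; rewrite (_ : Zforest R k F =
    fun N => \prod_(t <- forest_seq F) Zptree R k (repr t) N); last first.
  by apply/funext => N; rewrite Zforest_seq.
have : {in forest_seq F, forall t, cvgn (Zptree R k (repr t))}.
  move=> t; rewrite -has_pred1 has_count count_forest_seq lt0n => tF.
  have := Fc t; rewrite -cmE_neq0 => /(_ tF).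
  by rewrite /root_dec; case: (repr t) => a s; exact: Zptree_cvg.
elim: (forest_seq F) => [_|t s IHs IH].
  by under eq_fun do rewrite big_nil; exact: is_cvg_cst.
under eq_fun do rewrite big_cons.
apply: is_cvgM; first exact: IH (mem_head _ _).
by apply: IHs => u us; apply: IH; rewrite inE us orbT.
Qed.

(** * The morphism property *)

Lemma convergent_mmul F G : convergent (mmul F G) = convergent F && convergent G.
Proof.
apply/idP/andP => [|[]]; last exact: convergentM.
by rewrite /convergent mdomD => /allP FG; split; apply/allP => t tF;
  apply: FG; rewrite inE tF ?orbT.
Qed.

(** The value 0 on divergent forests, rather than the unspecified limit, makes
this map multiplicative on all forests. *)
Definition zeta_conv (F : forest) : R :=
  if convergent F then limn (Zforest R k F) else 0.

(** When a factor diverges, so does the product, and both sides are 0. *)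
Lemma zeta_conv_mmorphism : mmorphism zeta_conv.
Proof.
split=> [F G|]; rewrite /zeta_conv.
  rewrite convergent_mmul; have [Fc|] := boolP (convergent F); last by rewrite mul0r.
  have [Gc|] := boolP (convergent G); last by rewrite mulr0.
  rewrite /= -limM; [|exact: Zforest_cvg..].
  have -> // : Zforest R k (mmul F G) = Zforest R k F \* Zforest R k G.
  by apply/funext => N; rewrite ZforestM.
have -> : convergent mone by rewrite /convergent mdom1; apply/allP => t; rewrite inE.
rewrite (_ : Zforest R k mone = cst 1) ?lim_cst //.
by apply/funext => N; rewrite Zforest1.
Qed.

Lemma zeta_morphism :
  let z := fun p : Fconv R => mmap idfun (fun F => limn (Zforest R k F)) (val p) in
  linear (z : Fconv R -> R^o) /\ GRing.monoid_morphism z.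
Proof.
pose h : MMorphism.type forest R :=
  HB.pack zeta_conv (isMultiplicative.Build forest R zeta_conv zeta_conv_mmorphism).
move=> z; have zE p : z p = mmap idfun h (val p).
  rewrite /z /mmap; apply: eq_big_seq => F Fp; congr (_ * _).
  by rewrite /h /= /zeta_conv; case: p Fp => p /= /allP pc /pc ->.
split=> [c p q|]; first by rewrite !zE linearP.
by split=> [|p q]; rewrite !zE ?rmorphM ?rmorph1.
Qed.

End Convergence.

Theorem proposition3p16 (R : realType) :
  (linear (@zeta_st R : Fconv R -> R^o) /\
     GRing.monoid_morphism (@zeta_st R : Fconv R -> R)) /\
  (linear (@zeta_st_star R : Fconv R -> R^o) /\
     GRing.monoid_morphism (@zeta_st_star R : Fconv R -> R)).
Proof. by split; apply: zeta_morphism. Qed.
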